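(* Let $n\ge 4$, let $\mathbb{K}$ be a field, and let $G$ be a finite simple graph on $[n]$ with no isolated vertices. Suppose that $G$ is a disconnected forest. Then all graded Betti numbers $\beta_{i,j}(I_c(G))$ with $(i,j)\notin\{(0,n-2),(1,n-1),(1,n)\}$ vanish, and: (1) $\beta_{0,n-2}(I_c(G))=n-c$, where $c$ is the number of connected components of $G$. (2) $\beta_{1,n}(I_c(G))\neq 0$. (3) $\beta_{1,n-1}(I_c(G))\neq 0$ if and only if $G$ is not a disjoint union of edges.
   Context: $S=\mathbb{K}[x_1,\dots,x_n]$ is the standard graded polynomial ring and $[n]=\{1,\dots,n\}$. For a simple graph $G$ with vertex set $[n]$ and edge set $E(G)$, the complementary edge ideal is $I_c(G)=(x_1\cdots x_n/(x_ix_j) : \{i,j\}\in E(G))\subset S$. For a graded ideal $I\subset S$, $\beta_{i,j}(I)=\dim_{\mathbb{K}}\operatorname{Tor}_i^S(I,\mathbb{K})_j$. A forest is a graph with no cycles; a graph is a disjoint union of edges if every connected component consists of a single edge and its two endpoints. *)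

(* Defs.v *)
From HB Require Import structures.
From mathcomp Require Import all_boot all_order all_algebra.
From mathcomp.multinomials Require Import freeg mpoly.
From Stdlib Require Import ClassicalEpsilon.

Set Implicit Arguments.
Unset Strict Implicit.
Unset Printing Implicit Defensive.

Import GRing.Theory.
Local Open Scope ring_scope.

Section Graph.
Variables (n : nat) (e : rel 'I_n).

Definition simple_graph : Prop := ssrbool.symmetric e /\ irreflexive e.

Definition no_isolated_vertex : Prop := forall u, exists v, e u v.

(* A graph cycle is a closed walk through at least 3 pairwise distinct
   vertices; a shorter [ucycle] is not a cycle of the graph ([:: u; v] runs
   twice along one edge). *)
Definition forest : Prop := forall p : seq 'I_n, (2 < size p)%N -> ~ ucycle e p.

Definition num_components : nat := n_comp e 'I_n.

Definition disconnected : Prop := exists u v, ~~ connect e u v.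

Definition component (u : 'I_n) : {set 'I_n} := [set v | connect e u v].

Definition disjoint_union_of_edges : Prop :=
  forall u, exists v, e u v /\ component u = [set u; v].

End Graph.

Section Ideal.
Variables (n : nat) (K : fieldType).
Local Notation S := {mpoly K[n]}.

Definition ideal_generated_by (P : S -> Prop) (f : S) : Prop :=
  exists (m : nat) (a g : 'I_m -> S),
    (forall k, P (g k)) /\ f = \sum_(k < m) a k * g k.

Definition complementary_edge_monomial (i j : 'I_n) : S :=
  \prod_(k < n | (k != i) && (k != j)) 'X_k.

Definition complementary_edge_ideal (e : rel 'I_n) : S -> Prop :=
  ideal_generated_by
    (fun g => exists i j, e i j /\ g = complementary_edge_monomial i j).

(* Graded free resolutions  ... -> F_2 -> F_1 -> F_0 -> I -> 0  over S, by
   finitely generated free modules.  F_i is the space of row vectors of length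
   [fr_rank i], graded so that its b-th basis vector has degree [fr_deg b]
   (that is, F_i is the direct sum of the S(- fr_deg b)).  Maps act on row
   vectors by right multiplication. *)
Record graded_free_resolution (I : S -> Prop) := GradedFreeResolution {
  fr_rank : nat -> nat;
  fr_deg : forall i, 'I_(fr_rank i) -> int;
  fr_diff : forall i, 'M[S]_(fr_rank i.+1, fr_rank i);
  fr_aug : 'cV[S]_(fr_rank 0);
  fr_diff_graded : forall i a b m, m \in msupp (fr_diff i a b) ->
    (mdeg m)%:Z + fr_deg b = fr_deg a;
  fr_aug_graded : forall a m, m \in msupp (fr_aug a 0) ->
    (mdeg m)%:Z = fr_deg a;
  fr_aug_image : forall f : S,
    I f <-> exists u : 'rV_(fr_rank 0), (u *m fr_aug) 0 0 = f;
  fr_exact0 : forall u : 'rV_(fr_rank 0),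
    u *m fr_aug = 0 <-> exists v : 'rV_(fr_rank 1), u = v *m fr_diff 0;
  fr_exactS : forall i (u : 'rV_(fr_rank i.+1)),
    u *m fr_diff i = 0 <-> exists v : 'rV_(fr_rank i.+2), u = v *m fr_diff i.+1
}.

Section Tor.
Variables (I : S -> Prop) (F : graded_free_resolution I).

(* K is S / (x_1, ..., x_n), so tensoring F_i with K gives the row vectors over
   K of length [fr_rank F i], and the tensored differential is obtained by
   evaluating all the entries at the origin. *)
Definition tensor_diff (i : nat) : 'M[K]_(fr_rank F i.+1, fr_rank F i) :=
  map_mx (meval (fun=> 0)) (fr_diff F i).

(* The row space of [tensor_part i j] is the degree j part of F_i tensored
   with K: it is spanned by the basis vectors of degree j. *)
Definition tensor_part (i : nat) (j : int) : 'M[K]_(fr_rank F i) :=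
  diag_mx (\row_b (fr_deg b == j)%:R).

Definition tensor_cycles (i : nat) : 'M[K]_(fr_rank F i) :=
  match i return 'M[K]_(fr_rank F i) with
  | 0%N => 1%:M
  | i'.+1 => kermx (tensor_diff i')
  end.

(* The dimension of Tor_i(I, K)_j computed with F: cycles of degree j modulo
   boundaries of degree j.  The boundaries are contained in the cycles, so the
   subtraction is the dimension of the quotient. *)
Definition tor_dim (i : nat) (j : int) : nat :=
  (\rank (tensor_part i j :&: tensor_cycles i)%MS
     - \rank (tensor_part i.+1 j *m tensor_diff i))%N.

End Tor.

(* Tor does not depend on the resolution, so for a graded ideal I this selects
   the only possible value. *)
Definition graded_betti (I : S -> Prop) (i : nat) (j : int) : nat :=
  epsilon (inhabits 0%N)
    (fun b => exists F : graded_free_resolution I, tor_dim F i j = b).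

End Ideal.

(* Main.v *)
Require Import Defs.
From mathcomp Require Import all_boot all_order all_algebra.
From mathcomp.multinomials Require Import freeg mpoly.
From Stdlib Require Import ClassicalEpsilon.

Set Implicit Arguments.
Unset Strict Implicit.
Unset Printing Implicit Defensive.

Import GRing.Theory.
Local Open Scope ring_scope.

(** The ideal $I_c(G)$ of a forest has projective dimension one, and its minimal
resolution can be written down.

Build $G$ edge by edge, keeping the set $U$ of endpoints met so far.  As long
as some edge joins a vertex $v$ of $U$ to a vertex $w$ outside $U$, add it;
when there is none, $U$ is a union of components, and one restarts with an
edge $vw$ outside $U$.  Because $G$ has no cycle, all edges get listed
([greedy_spanning], [forest_listed]).  Every start opens a new component, so
there are $c$ starts ([num_starts_roots]), and counting the vertices brought
in by each step gives $n - c$ edges ([size_greedy]).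

Write $m_{vw} = x_1 \cdots x_n / (x_v x_w)$.  The vertex $w$ is in no earlier
edge, so $x_w$ divides all the earlier generators but not $m_{vw}$; hence the
colon ideal of the earlier generators by $m_{vw}$ is generated by $x_w$ when
$v$ was already met, and by $x_v x_w$ at a start ([edge_colon_vertex],
[edge_colon_edge]).  Since these colon ideals are principal, every edge but
the first adds exactly one free generator to the module of syzygies
([kernel_basis_cons]), of degree $n - 1$, respectively $n$.  The result is a
resolution
$0 \to S(-(n-1))^{n-2c} \oplus S(-n)^{c-1} \to S(-(n-2))^{n-c} \to I_c(G)$,
which is minimal because no degree is shared by the two free modules.  So
$\beta_{1,n} = c - 1$, which is positive as $G$ is disconnected, and
$\beta_{1,n-1} = n - 2c$ vanishes exactly when all edges are starts, that is, when no two edges meet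
([matching_starts], [starts_disjoint_union]).

To read the Betti numbers off this resolution one needs that [tor_dim] is the
same for all graded free resolutions.  This is the comparison theorem
([leq_tor_dim]): chain maps and homotopies between resolutions are constructed
one index at a time, and replacing each matrix entry by its homogeneous part of
the right degree makes the chain maps graded. *)

(** * Homogeneous matrices and their reduction at the origin *)

Section Graded.
Variables (n : nat) (K : fieldType).
Local Notation S := {mpoly K[n]}.

(** The index is an integer: the degree expected of a matrix entry is a
difference of two basis degrees, and the part is zero when this difference is
negative. *)
Definition homogeneous_part (d : int) (p : S) : S :=
  \sum_(m <- msupp p | (mdeg m)%:Z == d) p@_m *: 'X_[m].

Lemma mcoeff_homogeneous_part d (p : S) k :
  (homogeneous_part d p)@_k = if (mdeg k)%:Z == d then p@_k else 0.
Proof.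
rewrite /homogeneous_part raddf_sum /=.
have eq_k m : mcoeff k (p@_m *: 'X_[m]) = if m == k then p@_k else 0.
  by rewrite mcoeffZ mcoeffX; case: eqP => [->|_]; rewrite ?mulr1 ?mulr0.
rewrite (eq_bigr _ (fun m _ => eq_k m)) big_mkcond /=.
have [kp|kp] := boolP (k \in msupp p); last first.
  rewrite (memN_msupp_eq0 kp) if_same big1 // => m _.
  by case: ifP => // _; case: ifP.
rewrite (bigD1_seq k) ?msupp_uniq //= eqxx.
rewrite big1 ?addr0 // => m /negbTE ->.
by rewrite if_same.
Qed.

(** A matrix of degree zero between graded free modules; the condition is the
one imposed on the differentials of a resolution. *)
Definition homogeneous_mx (r s : nat) (dr : 'I_r -> int) (ds : 'I_s -> int)
    (M : 'M[S]_(r, s)) : Prop :=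
  forall a b m, m \in msupp (M a b) -> (mdeg m)%:Z + ds b = dr a.

Definition homogeneous_part_mx (r s : nat) (dr : 'I_r -> int)
    (ds : 'I_s -> int) (M : 'M[S]_(r, s)) : 'M[S]_(r, s) :=
  \matrix_(a, b) homogeneous_part (dr a - ds b) (M a b).

Lemma homogeneous_part_mxP r s dr ds (M : 'M[S]_(r, s)) :
  homogeneous_mx dr ds (homogeneous_part_mx dr ds M).
Proof.
move=> a b m; rewrite mxE mcoeff_msupp mcoeff_homogeneous_part.
by case: (eqVneq (mdeg m)%:Z) => [-> _|_]; rewrite ?subrK // eqxx.
Qed.

Lemma homogeneous_part_mx_id r s dr ds (M : 'M[S]_(r, s)) :
  homogeneous_mx dr ds M -> homogeneous_part_mx dr ds M = M.
Proof.
move=> hM; apply/matrixP => a b; rewrite mxE; apply/mpolyP => m.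
rewrite mcoeff_homogeneous_part; case: ifP => // hm.
have [/hM hd|/memN_msupp_eq0 //] := boolP (m \in msupp (M a b)).
by rewrite -hd addrK eqxx in hm.
Qed.

Lemma homogeneous_part_sum d (I : Type) (r : seq I) (F : I -> S) :
  homogeneous_part d (\sum_(i <- r) F i)
    = \sum_(i <- r) homogeneous_part d (F i).
Proof.
apply/mpolyP => k; rewrite mcoeff_homogeneous_part !(raddf_sum (mcoeff k)).
case: ifP => kd; last first.
  by rewrite big1 // => i _ /=; rewrite mcoeff_homogeneous_part kd.
by apply: eq_bigr => i _ /=; rewrite mcoeff_homogeneous_part kd.
Qed.

(** Multiplication by a form of degree [e] shifts homogeneous parts by [e]: the
parts of [p] of degree other than [d] contribute nothing in degree [d + e]. *)
Lemma homogeneous_partM d e (p q : S) :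
  (forall m, m \in msupp q -> (mdeg m)%:Z = e) ->
  homogeneous_part (d + e) (p * q) = homogeneous_part d p * q.
Proof.
move=> hq; apply/mpolyP => k; rewrite mcoeff_homogeneous_part.
have split_supp (p' : S) : k \in msupp (p' * q) ->
    exists2 m, m \in msupp p' & (mdeg k)%:Z = (mdeg m)%:Z + e.
  case/msuppM_le/allpairsP => -[m1 m2] [/= h1 h2 ->].
  by exists m1; rewrite // mdegD PoszD (hq _ h2).
case: ifP => [/eqP kd|kd]; last first.
  apply/esym/memN_msupp_eq0/negP => /split_supp [m].
  rewrite mcoeff_msupp mcoeff_homogeneous_part.
  case: ((mdeg m)%:Z =P d) => [-> _ kde|_]; last by rewrite eqxx.
  by rewrite kde eqxx in kd.
rewrite -[p in LHS](subrK (homogeneous_part d p)) mulrDl mcoeffD.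
rewrite [X in X + _](_ : _ = 0) ?add0r //.
apply/memN_msupp_eq0/negP => /split_supp [m]; rewrite kd mcoeff_msupp.
rewrite mcoeffB mcoeff_homogeneous_part => hm /addIr dm.
by rewrite dm eqxx subrr eqxx in hm.
Qed.

(** This turns an arbitrary lift through a graded map into a graded one: if
[M *m N] and [N] are graded, [M] may be replaced by its homogeneous part. *)
Lemma homogeneous_part_mulmx r s t dr ds dt
    (M : 'M[S]_(r, s)) (N : 'M[S]_(s, t)) :
  homogeneous_mx ds dt N ->
  homogeneous_part_mx dr dt (M *m N) = homogeneous_part_mx dr ds M *m N.
Proof.
move=> hN; apply/matrixP => a c; rewrite !mxE homogeneous_part_sum.
apply: eq_bigr => b _; rewrite mxE -[dr a in LHS](subrK (ds b)) -addrA.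
by apply: homogeneous_partM => m /hN <-; rewrite addrK.
Qed.

Lemma homogeneous_mulmx r s t dr ds dt
    (M : 'M[S]_(r, s)) (N : 'M[S]_(s, t)) :
  homogeneous_mx dr ds M -> homogeneous_mx ds dt N ->
  homogeneous_mx dr dt (M *m N).
Proof.
move=> hM hN; rewrite -(homogeneous_part_mx_id hM).
by rewrite -(homogeneous_part_mulmx dr M hN); apply: homogeneous_part_mxP.
Qed.

Local Notation at0 := (map_mx (meval (fun=> 0 : K))).

Definition degree_projector (r : nat) (dr : 'I_r -> int) (j : int) : 'M[K]_r :=
  diag_mx (\row_b (dr b == j)%:R).

Lemma meval0_no_constant (p : S) : 0%MM \notin msupp p -> meval (fun=> 0) p = 0.
Proof.
move=> p0; rewrite mevalE big_seq big1 // => m hm.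
have : mdeg m != 0%N by apply: contraNneq p0 => /eqP; rewrite mdeg_eq0 => /eqP <-.
rewrite mdegE sum_nat_eq0 negb_forall => /existsP [i /= mi].
by rewrite (bigD1 i) //= expr0n (negbTE mi) mul0r mulr0.
Qed.

(** A nonzero constant entry would join two basis vectors of equal degree. *)
Lemma homogeneous_at0 r s dr ds (M : 'M[S]_(r, s)) :
  homogeneous_mx dr ds M -> (forall a b, dr a != ds b) -> at0 M = 0.
Proof.
move=> hM dne; apply/matrixP => a b; rewrite !mxE meval0_no_constant //.
by apply: contra (dne a b) => /hM; rewrite mdeg0 add0r => ->.
Qed.

Lemma degree_projector_comm r s dr ds (M : 'M[S]_(r, s)) j :
  homogeneous_mx dr ds M ->
  degree_projector dr j *m at0 M = at0 M *m degree_projector ds j.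
Proof.
move=> hM; apply/matrixP => a b; rewrite mul_diag_mx mul_mx_diag !mxE mulrC.
have [/hM|h0] := boolP (0%MM \in msupp (M a b)); last first.
  by rewrite meval0_no_constant // !mul0r.
by rewrite mdeg0 add0r => ->.
Qed.

Lemma degree_projector_idem r (dr : 'I_r -> int) j :
  degree_projector dr j *m degree_projector dr j = degree_projector dr j.
Proof.
apply/matrixP => a b; rewrite mul_diag_mx !mxE.
by case: (dr a == j); rewrite ?mul1r // !mul0r mul0rn.
Qed.

Lemma sub_degree_projector m r (dr : 'I_r -> int) j (A : 'M[K]_(m, r)) :
  (A <= degree_projector dr j)%MS = (A *m degree_projector dr j == A).
Proof.
apply/idP/eqP => [/submxP [B ->]|<-]; last exact: submxMl.
by rewrite -mulmxA degree_projector_idem.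
Qed.

(** The projector factors as [A^T *m A], where the rows of [A] are the unit
vectors of the basis vectors of degree [j]. *)
Lemma rank_degree_projector r (dr : 'I_r -> int) j :
  \rank (degree_projector dr j) = #|[pred b | dr b == j]|.
Proof.
set P := [pred b | dr b == j].
pose A : 'M[K]_(#|P|, r) := \matrix_(i, b) (enum_val i == b)%:R.
have freeA : row_free A.
  apply/row_freeP; exists A^T; apply/matrixP => i i'; rewrite !mxE.
  rewrite (bigD1 (enum_val i)) //= big1 => [|b]; last first.
    by rewrite !mxE eq_sym => /negbTE ->; rewrite mul0r.
  by rewrite !mxE eqxx mul1r addr0 (inj_eq enum_val_inj) eq_sym.
suff -> : degree_projector dr j = A^T *m A.
  by rewrite mxrankMfree // mxrank_tr; apply/eqP.
apply/matrixP => a b; rewrite !mxE.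
have [Pa|Pa] := boolP (a \in P); last first.
  have -> : (dr a == j) = false by apply/negbTE.
  rewrite mul0rn big1 // => i _; rewrite !mxE.
  case: eqP => [ia|_]; last by rewrite mul0r.
  by rewrite -ia enum_valP in Pa.
have -> : dr a == j by [].
rewrite (bigD1 (enum_rank_in Pa a)) //= !mxE enum_rankK_in // eqxx mul1r.
rewrite big1 ?addr0 // => i ia; rewrite !mxE.
case: eqP => [ia'|_]; last by rewrite mul0r.
by have := enum_valK_in Pa i; rewrite ia' => ri; rewrite ri eqxx in ia.
Qed.

End Graded.

(** The hypotheses make [f] induce an injection of [Z / B] into [Z' / B']; a
complement of [B] in [Z] stands for the first quotient. *)
Lemma leq_rank_quotient (K : fieldType) (m1 m2 m3 m4 r s : nat)
    (Z : 'M[K]_(m1, r)) (B : 'M_(m2, r)) (Z' : 'M_(m3, s)) (B' : 'M_(m4, s))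
    (f : 'M_(r, s)) :
  (B <= Z)%MS -> (B' <= Z')%MS -> (Z *m f <= Z')%MS ->
  (forall z : 'rV_r, (z <= Z)%MS -> (z *m f <= B')%MS -> (z <= B)%MS) ->
  (\rank Z - \rank B <= \rank Z' - \rank B')%N.
Proof.
move=> BZ BZ' ZfZ' inj; set C := (Z :\: B)%MS.
have C0 (z : 'rV_r) : (z <= C)%MS -> (z *m f <= B')%MS -> z = 0.
  move=> zC zf; apply/eqP; rewrite -submx0 -(capmx_diff Z B) sub_capmx.
  rewrite -/C zC inj //; exact: submx_trans zC (diffmxSl _ _).
have rC : \rank (C *m f) = \rank C.
  apply/mxrank_injP; rewrite -submx0; apply/rV_subP => z.
  rewrite sub_capmx => /andP [zC /sub_kermxP zf].
  by rewrite (C0 z) ?sub0mx // zf sub0mx.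
have disj : (C *m f :&: B')%MS = 0.
  apply/eqP; rewrite -submx0; apply/rV_subP => z.
  rewrite sub_capmx => /andP [/submxP [u ->] zB'].
  by rewrite mulmxA (C0 (u *m C)) ?submxMl ?mul0mx ?sub0mx // -mulmxA.
have rZ : (\rank B + \rank C = \rank Z)%N.
  by rewrite -(mxrank_cap_compl Z B) (capmx_idPr BZ).
have : (\rank (C *m f + B')%MS <= \rank Z')%N.
  apply: mxrankS; rewrite addsmx_sub BZ' andbT.
  by apply: submx_trans ZfZ'; apply/submxMr/diffmxSl.
rewrite mxrank_disjoint_sum // rC => le.
by rewrite -rZ addKn leq_subRL 1?addnC //; apply: leq_trans le; apply: leq_addl.
Qed.

(** Chain maps and homotopies are infinite families in which each member is
chosen from the previous one; the invariant [P] is what makes the next choice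
possible. *)
Lemma dependent_choice (T : nat -> Type) (P : forall i, T i -> Prop)
    (R : forall i, T i -> T i.+1 -> Prop) :
  (exists x, P 0%N x) ->
  (forall i x, P i x -> exists y, P i.+1 y /\ R i x y) ->
  exists f : forall i, T i, forall i, P i (f i) /\ R i (f i) (f i.+1).
Proof.
move=> /constructive_indefinite_description [x0 Px0] step.
pose next i (x : {x | P i x}) := constructive_indefinite_description _
  (step i (proj1_sig x) (proj2_sig x)).
pose f := fix f i : {x | P i x} := match i with
  | 0%N => exist _ x0 Px0
  | i'.+1 => exist _ _ (proj1 (proj2_sig (next i' (f i'))))
  end.
exists (fun i => proj1_sig (f i)) => i; split; first exact: proj2_sig.
exact: (proj2 (proj2_sig (next i (f i)))).
Qed.

(** * Independence of Tor from the resolution *)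

Section Comparison.
Variables (n : nat) (K : fieldType) (I : {mpoly K[n]} -> Prop).
Local Notation S := {mpoly K[n]}.
Implicit Types F G : graded_free_resolution I.
Local Notation at0 := (map_mx (meval (fun=> 0 : K))).

(** The augmentation plays the role of the differential out of index zero, so
that exactness reads the same at every index. *)
Definition is_cycle F (i : nat) : 'rV[S]_(fr_rank F i) -> Prop :=
  match i return 'rV[S]_(fr_rank F i) -> Prop with
  | 0%N => fun u => u *m fr_aug F = 0
  | i'.+1 => fun u => u *m fr_diff F i' = 0
  end.

Lemma is_cycleP F i (u : 'rV_(fr_rank F i)) :
  is_cycle u <-> exists v, u = v *m fr_diff F i.
Proof. by case: i u => [|i] u; [apply: fr_exact0|apply: fr_exactS]. Qed.

Lemma lift_rows F i r (M : 'M[S]_(r, fr_rank F i)) :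
  (forall a, is_cycle (row a M)) -> exists H, M = H *m fr_diff F i.
Proof.
move=> hM; have /fin_all_exists [f hf] a := (is_cycleP _).1 (hM a).
exists (\matrix_a f a); apply/row_matrixP => a.
by rewrite row_mul rowK hf.
Qed.

Lemma is_cycle_row_diff F i a : is_cycle (row a (fr_diff F i)).
Proof. by apply/is_cycleP; exists (delta_mx 0 a); rewrite rowE. Qed.

Lemma fr_diff_diff F i : fr_diff F i.+1 *m fr_diff F i = 0.
Proof.
apply/row_matrixP => a; rewrite row_mul row0.
exact: (is_cycle_row_diff a).
Qed.

Lemma fr_diff_homogeneous F i :
  homogeneous_mx (@fr_deg _ _ _ F i.+1) (@fr_deg _ _ _ F i) (fr_diff F i).
Proof. by move=> a b m; apply: fr_diff_graded. Qed.

Lemma fr_aug_homogeneous F :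
  homogeneous_mx (@fr_deg _ _ _ F 0) (fun=> 0) (fr_aug F).
Proof. by move=> a b m; rewrite ord1 addr0; apply: fr_aug_graded. Qed.

Definition augmentation_compatible F G (i : nat) :
    'M[S]_(fr_rank F i, fr_rank G i) -> Prop :=
  match i return 'M[S]_(fr_rank F i, fr_rank G i) -> Prop with
  | 0%N => fun M => M *m fr_aug G = fr_aug F
  | _ => fun _ => True
  end.

(** Lift the augmentation, then each differential in turn; a map that sends
cycles to cycles can always be lifted once more, as the rows of [fr_diff F i
*m M] are then boundaries of [G]. *)
Lemma chain_map_exists F G :
  exists phi : forall i, 'M[S]_(fr_rank F i, fr_rank G i),
    [/\ forall i, homogeneous_mx (@fr_deg _ _ _ F i) (@fr_deg _ _ _ G i) (phi i),
        phi 0%N *m fr_aug G = fr_aug F &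
        forall i, fr_diff F i *m phi i = phi i.+1 *m fr_diff G i].
Proof.
pose P i (M : 'M[S]_(fr_rank F i, fr_rank G i)) :=
  [/\ homogeneous_mx (@fr_deg _ _ _ F i) (@fr_deg _ _ _ G i) M,
      forall u, is_cycle u -> is_cycle (u *m M) & augmentation_compatible M].
have [||phi hphi] := @dependent_choice _ P
    (fun i M N => fr_diff F i *m M = N *m fr_diff G i); last first.
- exists phi; split=> [i||i]; last by have [] := hphi i.
  + by have [[]] := hphi i.
  + by have [[]] := hphi 0%N.
- move=> i M [hM cM _].
  have [a|H eqH] := @lift_rows G i _ (fr_diff F i *m M).
    by rewrite row_mul; apply/cM/is_cycle_row_diff.
  pose N := homogeneous_part_mx (@fr_deg _ _ _ F i.+1) (@fr_deg _ _ _ G i.+1) H.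
  have eqN : fr_diff F i *m M = N *m fr_diff G i.
    rewrite -(homogeneous_part_mulmx _ _ (@fr_diff_homogeneous G i)) -eqH.
    apply/esym/homogeneous_part_mx_id.
    exact: homogeneous_mulmx (@fr_diff_homogeneous F i) hM.
  exists N; split=> //; split=> // [|u uD]; first exact: homogeneous_part_mxP.
  by rewrite /= -mulmxA -eqN mulmxA uD mul0mx.
(* The first member of the family lifts the augmentation, using that both
   augmentations have image [I]. *)
have augP a : exists u : 'rV_(fr_rank G 0), u *m fr_aug G = row a (fr_aug F).
  have /(fr_aug_image G) [u hu] : I (fr_aug F a 0).
    apply/(fr_aug_image F); exists (delta_mx 0 a).
    by rewrite -rowE mxE.
  by exists u; apply/rowP => k; rewrite ord1 hu mxE.
have /fin_all_exists [f hf] := augP.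
pose N := homogeneous_part_mx (@fr_deg _ _ _ F 0) (@fr_deg _ _ _ G 0)
  (\matrix_a f a).
have eqN : N *m fr_aug G = fr_aug F.
  rewrite -(homogeneous_part_mulmx _ _ (@fr_aug_homogeneous G)).
  rewrite (_ : _ *m _ = fr_aug F).
    by apply: homogeneous_part_mx_id; apply: fr_aug_homogeneous.
  by apply/row_matrixP => a; rewrite row_mul rowK hf.
exists N; split=> // [|u uA]; first exact: homogeneous_part_mxP.
by rewrite /= -mulmxA eqN.
Qed.

Definition base_homotopy F (theta : forall i, 'M[S]_(fr_rank F i)) (i : nat) :
    'M[S]_(fr_rank F i, fr_rank F i.+1) -> Prop :=
  match i return 'M[S]_(fr_rank F i, fr_rank F i.+1) -> Prop with
  | 0%N => fun h => theta 0%N - 1%:M = h *m fr_diff F 0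
  | _ => fun _ => True
  end.

(** A chain endomorphism over the identity is homotopic to the identity.  The
invariant says that [theta i - 1 - h i *m d] is killed by the next differential,
which makes the difference to be lifted at the next index a cycle. *)
Lemma homotopy_exists F (theta : forall i, 'M[S]_(fr_rank F i)) :
  theta 0%N *m fr_aug F = fr_aug F ->
  (forall i, fr_diff F i *m theta i = theta i.+1 *m fr_diff F i) ->
  exists h : forall i, 'M[S]_(fr_rank F i, fr_rank F i.+1),
    theta 0%N - 1%:M = h 0%N *m fr_diff F 0 /\
    forall i, theta i.+1 - 1%:M = h i.+1 *m fr_diff F i.+1 + fr_diff F i *m h i.
Proof.
move=> theta_aug theta_diff.
pose P i (h : 'M[S]_(fr_rank F i, fr_rank F i.+1)) :=
  fr_diff F i *m (theta i - 1%:M - h *m fr_diff F i) = 0 /\ base_homotopy theta h.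
have [||h hh] := @dependent_choice _ P (fun i h h' =>
  theta i.+1 - 1%:M = h' *m fr_diff F i.+1 + fr_diff F i *m h); last first.
- exists h; split=> [|i]; last by have [] := hh i.
  by have [[]] := hh 0%N.
- move=> i h [hP _].
  have [a|h' eqh] := @lift_rows F i.+1 _ (theta i.+1 - 1%:M - fr_diff F i *m h).
    rewrite /= -row_mul !mulmxBl mul1mx -theta_diff.
    by rewrite mulmxBr mulmxBr mulmxA mulmx1 in hP; rewrite hP row0.
  exists h'; split; last by rewrite -eqh subrK.
  split=> //; rewrite -eqh opprB addrC subrK.
  by rewrite mulmxA fr_diff_diff mul0mx.
have [a|h eqh] := @lift_rows F 0 _ (theta 0%N - 1%:M).
  by rewrite /= -row_mul mulmxBl mul1mx theta_aug subrr row0.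
by exists h; split=> //; rewrite -eqh subrr mulmx0.
Qed.

(** A chain map $F \to G$ followed by one back is homotopic to the identity,
so it is injective on homology; this gives one inequality, and the other by
symmetry. The homotopy need not be graded, because projecting a boundary to
degree [j] gives the boundary of a vector of degree [j]. *)
Lemma leq_tor_dim F G i j : (tor_dim F i j <= tor_dim G i j)%N.
Proof.
have [phi [phi_hom phi_aug phi_diff]] := chain_map_exists F G.
have [psi [psi_hom psi_aug psi_diff]] := chain_map_exists G F.
have [||h [h0 hS]] := @homotopy_exists F (fun i => phi i *m psi i).
- by rewrite -mulmxA psi_aug phi_aug.
- by move=> k; rewrite mulmxA phi_diff -mulmxA psi_diff mulmxA.
have tdiff (H : graded_free_resolution I) k :
    tensor_part H k.+1 j *m tensor_diff H k = tensor_diff H k *m tensor_part H k j.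
  exact/degree_projector_comm/fr_diff_homogeneous.
have tphi k : tensor_part F k j *m at0 (phi k) = at0 (phi k) *m tensor_part G k j.
  exact: degree_projector_comm.
have tpsi k : tensor_part G k j *m at0 (psi k) = at0 (psi k) *m tensor_part F k j.
  exact: degree_projector_comm.
have bdry_sub (H : graded_free_resolution I) k :
    (tensor_part H k.+1 j *m tensor_diff H k
       <= tensor_part H k j :&: tensor_cycles H k)%MS.
  rewrite sub_capmx {1}tdiff submxMl /=; case: k => [|k] /=; first exact: submx1.
  apply/sub_kermxP; rewrite -mulmxA /tensor_diff -map_mxM /= fr_diff_diff.
  by rewrite map_mx0 mulmx0.
apply: leq_rank_quotient (at0 (phi i)) _ _ _ _ => //.
- have /andP [ZP ZC] : (tensor_part F i j :&: tensor_cycles F i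
      <= tensor_part F i j)%MS && (tensor_part F i j :&: tensor_cycles F i
      <= tensor_cycles F i)%MS by rewrite capmxSl capmxSr.
  rewrite sub_capmx; apply/andP; split.
    by apply: (submx_trans (submxMr _ ZP)); rewrite tphi submxMl.
  case: (i) ZC => [_|k] /=; first exact: submx1.
  move=> /sub_kermxP ZC; apply/sub_kermxP; rewrite -mulmxA.
  by rewrite /tensor_diff -map_mxM /= -phi_diff map_mxM mulmxA ZC mul0mx.
move=> z; rewrite sub_capmx sub_degree_projector => /andP [/eqP zP zC].
move=> /submxP [w eqw].
set B := (tensor_part F i.+1 j *m tensor_diff F i).
pose t := z *m at0 (phi i) *m at0 (psi i).
(* [t] is the image of [z] under the two chain maps; it is a boundary, and
   differs from [z] by another one. *)
have tB : (t <= B)%MS.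
  rewrite /t eqw -!mulmxA /tensor_diff -[at0 (fr_diff G i) *m _]map_mxM /= psi_diff.
  by rewrite map_mxM (mulmxA (tensor_part _ _ _)) tpsi -mulmxA mulmxA submxMl.
have eqt : t - z = z *m at0 (h i) *m tensor_diff F i.
  have at0_1 : at0 (1%:M : 'M[S]_(fr_rank F i)) = 1%:M by apply: map_mx1.
  rewrite /t -mulmxA -map_mxM /= -{2}[z]mulmx1 -mulmxBr -at0_1 -map_mxB /=.
  move: at0_1 => _; case: (i) z zC {zP eqw t tB} => [|k] z /= zC.
    by rewrite h0 map_mxM mulmxA.
  rewrite hS map_mxD mulmxDr !map_mxM !mulmxA.
  by rewrite (sub_kermxP zC) mul0mx addr0.
have tP : t *m tensor_part F i j = t.
  by rewrite /t -!mulmxA -tpsi (mulmxA (at0 _)) -tphi !mulmxA zP.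
have : (t - z <= B)%MS.
  have -> : t - z = (t - z) *m tensor_part F i j by rewrite mulmxBl tP zP.
  by rewrite eqt -mulmxA -tdiff submxMl.
by move=> tzB; rewrite -[z](subKr t) addmx_sub // eqmx_opp.
Qed.

Lemma tor_dim_unique F G i j : tor_dim F i j = tor_dim G i j.
Proof. by apply/eqP; rewrite eqn_leq !leq_tor_dim. Qed.

Lemma graded_betti_tor_dim F i j : graded_betti I i j = tor_dim F i j.
Proof.
have : exists b, exists F, @tor_dim n K I F i j = b by exists (tor_dim F i j), F.
move=> /(epsilon_spec (inhabits 0%N)) [G eqG].
by rewrite /graded_betti -eqG; apply: tor_dim_unique.
Qed.

Lemma graded_betti_minimal F i j :
  (forall k, tensor_diff F k = 0) ->
  graded_betti I i j = #|[pred b : 'I_(fr_rank F i) | fr_deg b == j]|.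
Proof.
move=> minF; rewrite (graded_betti_tor_dim F) /tor_dim minF mulmx0 mxrank0 subn0.
have cT : (tensor_part F i j <= tensor_cycles F i)%MS.
  by case: (i) => [|k] /=; rewrite ?submx1 // minF; apply/sub_kermxP; rewrite mulmx0.
by rewrite (capmx_idPl cT) -(rank_degree_projector K (@fr_deg _ _ _ F i) j).
Qed.

End Comparison.

(** * Free resolutions of length one *)

Section KernelBasis.
Variable R : idomainType.

(** The rows of [D] form a basis of the syzygies of the entries of [A]. *)
Definition kernel_basis (k m : nat) (A : 'cV[R]_m) (D : 'M[R]_(k, m)) : Prop :=
  [/\ D *m A = 0,
      forall u : 'rV_m, u *m A = 0 -> exists v, u = v *m D &
      forall v : 'rV_k, v *m D = 0 -> v = 0].

Lemma kernel_basis_single (g : R) :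
  g != 0 -> kernel_basis (g%:M : 'cV_1) (0 : 'M_(0, 1)).
Proof.
move=> g0; split=> [|u|v _]; rewrite ?mul0mx // ?[v]thinmx0 //.
rewrite mul_mx_scalar => /matrixP /(_ 0 0); rewrite !mxE => /eqP.
rewrite mulf_eq0 (negbTE g0) /= => /eqP u0; exists 0; rewrite mul0mx.
by apply/rowP => i; rewrite ord1 u0 mxE.
Qed.

(** Adding a generator [g] whose colon ideal with respect to the others is
generated by one element [c]. The first coordinates of the syzygies fill the
principal ideal of [c]; the relation [c * g = r *m A] realizes [c], and
subtracting a multiple of it reduces any syzygy to the earlier ones. *)
Lemma kernel_basis_cons (k m : nat) (A : 'cV[R]_m) (D : 'M[R]_(k, m))
    (g c : R) (r : 'rV_m) :
  kernel_basis A D -> c != 0 -> c * g = (r *m A) 0 0 ->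
  (forall a (u : 'rV_m), a * g + (u *m A) 0 0 = 0 -> exists q, a = q * c) ->
  kernel_basis (col_mx g%:M A : 'cV_(1 + m))
               (block_mx c%:M (- r) 0 D : 'M_(1 + k, 1 + m)).
Proof.
move=> [DA exact_A injD] c0 cg colon.
have cgM : (c%:M *m g%:M : 'M_1) = r *m A.
  by rewrite -scalar_mxM [r *m A]mx11_scalar cg.
split=> [|u|v].
- by rewrite mul_block_col cgM mulNmx subrr mul0mx add0r DA col_mx0.
- rewrite -[u]hsubmxK [lsubmx u]mx11_scalar; move: (lsubmx u 0 0) (rsubmx u).
  move=> a {}u; rewrite mul_row_col => ua.
  have [q eq_a] : exists q, a = q * c.
    apply: (colon a u); move/matrixP/(_ 0 0): ua.
    by rewrite -scalar_mxM mxE [(a * g)%:M _ _]mxE eqxx mulr1n [X in _ = X]mxE.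
  have [v eq_v] : exists v, u + q *: r = v *m D.
    apply: exact_A; rewrite mulmxDl -scalemxAl -cgM -ua addrC; congr (_ + _).
    by rewrite -!scalar_mxM scale_scalar_mx eq_a mulrA.
  exists (row_mx q%:M v); rewrite mul_row_block mulmx0 addr0 -scalar_mxM eq_a.
  by rewrite -eq_v mul_scalar_mx scalerN addrC addrK.
rewrite -[v]hsubmxK [lsubmx v]mx11_scalar; move: (lsubmx v 0 0) (rsubmx v).
move=> b {}v; rewrite mul_row_block mulmx0 addr0 -scalar_mxM -row_mx0.
move=> /eq_row_mx [/matrixP/(_ 0 0) + vD].
rewrite !mxE mulr1n => /eqP; rewrite mulf_eq0 (negbTE c0) orbF => /eqP b0.
move: vD; rewrite b0 mul_scalar_mx scale0r add0r => /injD ->.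
by rewrite raddf0 row_mx0.
Qed.

End KernelBasis.

Section LengthOne.
Variables (n : nat) (K : fieldType).
Local Notation S := {mpoly K[n]}.
Local Notation at0 := (map_mx (meval (fun=> 0 : K))).

Section Resolution.
Variables (I : S -> Prop) (k m : nat) (A : 'cV[S]_m) (D : 'M[S]_(k, m)).
Variables (dA : 'I_m -> int) (dD : 'I_k -> int).
Hypotheses (homA : homogeneous_mx dA (fun=> 0) A) (homD : homogeneous_mx dD dA D).
Hypotheses (basisD : kernel_basis A D).
Hypothesis imageA : forall f, I f <-> exists u : 'rV_m, (u *m A) 0 0 = f.

Definition length_one_rank (i : nat) : nat :=
  match i with 0%N => m | 1%N => k | _ => 0%N end.

Definition length_one_deg (i : nat) : 'I_(length_one_rank i) -> int :=
  match i return 'I_(length_one_rank i) -> int with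
  | 0%N => dA | 1%N => dD | _ => fun=> 0
  end.

Definition length_one_diff (i : nat) :
    'M[S]_(length_one_rank i.+1, length_one_rank i) :=
  match i return 'M[S]_(length_one_rank i.+1, length_one_rank i) with
  | 0%N => D | _ => 0
  end.

Lemma length_one_diff_graded i a b x : x \in msupp (length_one_diff i a b) ->
  (mdeg x)%:Z + @length_one_deg i b = @length_one_deg i.+1 a.
Proof.
case: i a b => [|i] a b /=; first exact: homD.
by rewrite mxE msupp0.
Qed.

Lemma length_one_aug_graded a x : x \in msupp (A a 0) ->
  (mdeg x)%:Z = @length_one_deg 0 a.
Proof. by move/homA; rewrite addr0. Qed.

Lemma length_one_exact0 (u : 'rV_(length_one_rank 0)) :
  u *m A = 0 <-> exists v : 'rV_(length_one_rank 1), u = v *m length_one_diff 0.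
Proof.
have [DA exA _] := basisD; split=> [/exA //|[v ->]].
by rewrite -mulmxA DA mulmx0.
Qed.

Lemma length_one_exactS i (u : 'rV_(length_one_rank i.+1)) :
  u *m length_one_diff i = 0 <->
  exists v : 'rV_(length_one_rank i.+2), u = v *m length_one_diff i.+1.
Proof.
have [_ _ injD] := basisD; split=> [|[v ->]]; last by rewrite mulmx0 mul0mx.
case: i u => [|i] u uD; exists 0; rewrite mul0mx; last exact: thinmx0.
exact: injD.
Qed.

Definition length_one_resolution : graded_free_resolution I :=
  GradedFreeResolution length_one_diff_graded length_one_aug_graded imageA
    length_one_exact0 length_one_exactS.

Hypothesis minimalD : at0 D = 0.

(** Minimality makes the reduced differential vanish, so that the Betti
numbers count basis vectors of each degree. *)
Lemma length_one_betti i j :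
  graded_betti I i j =
    match i with
    | 0%N => #|[pred b | dA b == j]|
    | 1%N => #|[pred b | dD b == j]|
    | _ => 0%N
    end.
Proof.
rewrite (@graded_betti_minimal _ _ _ length_one_resolution).
  case: i => [|[|i]] //=; apply: eq_card0 => b; by case: b.
by case=> [|l] //; rewrite /tensor_diff /= map_mx0.
Qed.

End Resolution.

Lemma homogeneous_block (k1 k2 m1 m2 : nat) (dr : 'I_(k1 + k2) -> int)
    (dc : 'I_(m1 + m2) -> int) (A : 'M[S]_(k1, m1)) B C D :
  homogeneous_mx (dr \o @lshift k1 k2) (dc \o @lshift m1 m2) A ->
  homogeneous_mx (dr \o @lshift k1 k2) (dc \o @rshift m1 m2) B ->
  homogeneous_mx (dr \o @rshift k1 k2) (dc \o @lshift m1 m2) C ->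
  homogeneous_mx (dr \o @rshift k1 k2) (dc \o @rshift m1 m2) D ->
  homogeneous_mx dr dc (block_mx A B C D).
Proof.
move=> hA hB hC hD a b x; rewrite -[a]splitK -[b]splitK.
case: (split a) => {}a; case: (split b) => {}b /=.
- by rewrite block_mxEul; apply: hA.
- by rewrite block_mxEur; apply: hB.
- by rewrite block_mxEdl; apply: hC.
by rewrite block_mxEdr; apply: hD.
Qed.

End LengthOne.

(** * Growing a forest edge by edge *)

Section GreedyOrder.
Variables (n : nat) (e : rel 'I_n).
Hypotheses (e_sym : ssrbool.symmetric e) (e_irr : irreflexive e).
Implicit Types (s : seq ('I_n * 'I_n)) (u v w x y z : 'I_n).

Fixpoint endpoints s : {set 'I_n} :=
  if s is x :: s' then x.1 |: (x.2 |: endpoints s') else set0.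

(** The most recent edge comes first, and the second vertex of each edge is
always new. A start is allowed only when no edge leaves the set of endpoints:
this is what makes starts correspond to connected components. *)
Inductive greedy : seq ('I_n * 'I_n) -> Prop :=
| greedy_nil : greedy [::]
| greedy_grow v w s : greedy s -> e v w -> v \in endpoints s ->
    w \notin endpoints s -> greedy ((v, w) :: s)
| greedy_start v w s : greedy s ->
    (forall x y, x \in endpoints s -> e x y -> y \in endpoints s) ->
    e v w -> v \notin endpoints s -> w \notin endpoints s ->
    greedy ((v, w) :: s).

Fixpoint num_starts s : nat :=
  if s is x :: s' then ((x.1 \notin endpoints s') + num_starts s')%N else 0%N.

Definition listed s : rel 'I_n := fun x y => ((x, y) \in s) || ((y, x) \in s).

Lemma listed_sym s : ssrbool.symmetric (listed s).
Proof. by move=> x y; rewrite /listed orbC. Qed.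

Lemma greedy_edge s x y : greedy s -> listed s x y -> e x y.
Proof.
rewrite /listed.
elim=> [|v w {}s _ IH evw _ _|v w {}s _ IH _ evw _ _];
  rewrite ?in_nil // !inE;
  by case/orP=> /orP [/eqP [-> ->]|h]; rewrite ?(e_sym w) // IH ?h ?orbT.
Qed.

Lemma listed_endpoints s x y : listed s x y -> x \in endpoints s.
Proof.
rewrite /listed; elim: s => [|[v w] s IH]; rewrite ?in_nil // !inE /=.
by case/orP=> /orP [/eqP [? ?]|h]; subst; rewrite ?eqxx ?orbT // IH ?h ?orbT.
Qed.

Lemma endpoints_listed s x : x \in endpoints s -> exists y, listed s x y.
Proof.
rewrite /listed; elim: s => [|[v w] s IH]; rewrite ?inE //=.
case/or3P=> [/eqP ->|/eqP ->|/IH [y hy]]; [exists w|exists v|exists y].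
- by rewrite !inE eqxx.
- by rewrite !inE eqxx orbT.
by case/orP: hy => hy; rewrite !inE hy ?orbT.
Qed.

(** A growing step brings one new vertex, a start brings two. *)
Lemma size_greedy s : greedy s -> #|endpoints s| = (size s + num_starts s)%N.
Proof.
elim=> [|v w {}s _ IH evw vs ws|v w {}s _ IH _ evw vs ws] /=.
- by rewrite cards0.
- rewrite vs /= (setUidPr _) ?sub1set ?inE ?vs ?orbT //.
  by rewrite cardsU1 ws IH add1n addSn.
have vw : v != w by apply: contraTneq evw => ->; rewrite e_irr.
by rewrite !cardsU1 !inE negb_or vw vs ws IH; rewrite addnCA !add1n addSn addnS.
Qed.

Lemma closed_connect s x y :
  (forall x y, x \in endpoints s -> e x y -> y \in endpoints s) ->
  x \in endpoints s -> connect e x y -> y \in endpoints s.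
Proof.
move=> closed_s xs /connectP [p ep ->]; elim: p x xs ep => //= z p IH x xs.
by case/andP=> /(closed_s _ _ xs) zs /(IH _ zs).
Qed.

Lemma e_connect_sym : connect_sym e.
Proof. exact: sym_connect_sym. Qed.

(** Every vertex met is connected to the start of its own component, and a start
is never connected to a vertex met before, as these form a closed set. *)
Lemma num_starts_roots s :
  greedy s -> num_starts s = #|[set fingraph.root e x | x in endpoints s]|.
Proof.
elim=> [|v w {}s _ IH evw vs ws|v w {}s _ IH closed_s evw vs ws] /=.
- by rewrite imset0 cards0.
- have rvw : fingraph.root e v = fingraph.root e w.
    by apply/(fingraph.rootP e_connect_sym)/connect1.
  rewrite vs (setUidPr _) ?sub1set ?inE ?vs ?orbT // imsetU1 -rvw.
  by rewrite (setUidPr _) ?IH // sub1set imset_f.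
have rvw : fingraph.root e v = fingraph.root e w.
  by apply/(fingraph.rootP e_connect_sym)/connect1.
rewrite vs !imsetU1 -rvw setUA setUid cardsU1 IH; congr (nat_of_bool _ + _)%N.
apply/esym/imsetP => -[x xs /(fingraph.rootP e_connect_sym)].
rewrite e_connect_sym => /(closed_connect closed_s xs).
by rewrite (negbTE vs).
Qed.

Lemma num_starts_gt0 s : greedy s -> s != [::] -> (0 < num_starts s)%N.
Proof.
move=> gs; rewrite num_starts_roots //; case: s gs => // x s _ _.
by apply/card_gt0P; exists (fingraph.root e x.1); rewrite imset_f // !inE eqxx.
Qed.

Lemma num_components_roots :
  num_components e = #|[set fingraph.root e x | x : 'I_n]|.
Proof.
rewrite /num_components /n_comp_mem; apply: eq_card => x.
rewrite !inE andbT; apply/eqP/imsetP => [rx|[y _ ->]]; first by exists x.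
exact: fingraph.root_root e_connect_sym _.
Qed.

(** At every stage the listed edges connect the endpoints met so far as much
as the whole graph does: a growing step hangs [w] on [v], and a start is
separated in the whole graph from all earlier endpoints. *)
Lemma connect_listed s x y : greedy s ->
  x \in endpoints s -> y \in endpoints s -> connect e x y ->
  connect (listed s) x y.
Proof.
have listed_cons a s' : subrel (connect (listed s')) (connect (listed (a :: s'))).
  apply: connect_sub => p q; rewrite /listed => pq; apply: connect1.
  by case/orP: pq => pq; rewrite !inE pq ?orbT.
have new v w s' : listed ((v, w) :: s') v w by rewrite /listed !inE eqxx.
have lsym s' : connect_sym (listed s') by apply: sym_connect_sym; apply: listed_sym.
move=> gs.
elim: gs x y => [|v w {}s _ IH evw vs ws|v w {}s _ IH closed_s evw vs ws] x y.
- by rewrite inE.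
- have vw : connect (listed ((v, w) :: s)) v w by apply/connect1/new.
  have evw' : connect e v w by apply: connect1.
  have old z : z \in endpoints ((v, w) :: s) -> exists z',
      [/\ z' \in endpoints s, connect e z z' & connect (listed ((v, w) :: s)) z z'].
    rewrite !inE => /or3P [/eqP ->|/eqP ->|zs]; [exists v|exists v|exists z]; split=> //.
      by rewrite e_connect_sym.
    by rewrite lsym.
  move=> /old [x' [xs ex lx]] /old [y' [ys ey ly]] exy.
  apply: connect_trans lx _; rewrite lsym; apply: connect_trans ly _.
  apply/listed_cons/IH => //; apply: connect_trans ex.
  by rewrite e_connect_sym; apply: connect_trans ey.
have vw : connect (listed ((v, w) :: s)) v w by apply/connect1/new.
have wv : connect (listed ((v, w) :: s)) w v by rewrite lsym.
have sep a b : a \in endpoints s -> b \notin endpoints s -> ~~ connect e a b.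
  by move=> sa; apply: contra => /(closed_connect closed_s sa).
rewrite !inE => /or3P [/eqP ->|/eqP ->|xs] /or3P [/eqP ->|/eqP ->|ys] //=;
  try by rewrite ?connect0.
- by rewrite e_connect_sym (negbTE (sep _ _ ys vs)).
- by rewrite e_connect_sym (negbTE (sep _ _ ys ws)).
- by rewrite (negbTE (sep _ _ xs vs)).
- by rewrite (negbTE (sep _ _ xs ws)).
by move=> /(IH _ _ xs ys); apply: listed_cons.
Qed.

(** If an edge were not listed, a simple path of listed edges between its ends
would have length at least two and the edge would close it into a cycle. *)
Lemma forest_listed s x y : forest e -> greedy s -> endpoints s = [set: 'I_n] ->
  e x y -> listed s x y.
Proof.
move=> forest_e gs full exy; apply: contraT => nxy.
have : connect (listed s) x y by apply: connect_listed; rewrite ?full ?inE ?connect1.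
case/connectP => p0 /shortenP [p lp up _] eq_y {p0}.
have ep : path e x p.
  by apply: sub_path lp => a b; apply: greedy_edge.
case: (forest_e (x :: p)); last first.
  by rewrite /ucycle up andbT /= rcons_path ep -eq_y e_sym.
(* The cycle has length at least three unless the path is the single listed
   step from [x] to [y]. *)
case: p lp eq_y {up ep} => [|a [|b p]] //= lp eq_y.
  by rewrite eq_y e_irr in exy.
by rewrite eq_y (andP lp).1 in nxy.
Qed.

(** The induction is on the number of vertices not yet met. *)
Lemma greedy_spanning : no_isolated_vertex e ->
  exists s, greedy s /\ endpoints s = [set: 'I_n].
Proof.
move=> noiso.
suff grow d s : greedy s -> (#|~: endpoints s| <= d)%N ->
    exists s, greedy s /\ endpoints s = [set: 'I_n].
  exact: (grow _ [::] greedy_nil (leqnn _)).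
elim: d s => [|d IH] s gs.
  rewrite leqn0 cards_eq0 => /eqP s0; exists s; split=> //.
  by rewrite -[endpoints s]setCK s0 setC0.
move=> sd.
have smaller v w : w \notin endpoints s -> greedy ((v, w) :: s) ->
    exists s, greedy s /\ endpoints s = [set: 'I_n].
  move=> ws gvw; apply: (IH _ gvw); rewrite -ltnS; apply: leq_trans sd.
  apply: proper_card; rewrite properC properE; apply/andP; split.
    by apply/subsetP => z zs; rewrite !inE zs !orbT.
  by apply/subsetPn; exists w; rewrite // !inE eqxx orbT.
have [/existsP [v /existsP [w /and3P [evw vs ws]]]|/existsPn closed_s] :=
  boolP [exists v, exists w, [&& e v w, v \in endpoints s & w \notin endpoints s]].
  exact: smaller ws (greedy_grow gs evw vs ws).
have {}closed_s x y : x \in endpoints s -> e x y -> y \in endpoints s.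
  move=> xs exy; move: (closed_s x) => /existsPn /(_ y).
  by rewrite exy xs negbK.
have [full|] := eqVneq (endpoints s) setT.
  by exists s.
rewrite -subTset => /subsetPn [v _ vs]; have [w evw] := noiso v.
have ws : w \notin endpoints s.
  by apply: contra vs => /closed_s; apply; rewrite e_sym.
exact: smaller ws (greedy_start gs closed_s evw vs ws).
Qed.

Lemma num_starts_le s : (num_starts s <= size s)%N.
Proof.
elim: s => //= x s IH; apply: (@leq_add _ _ 1) => //; exact: leq_b1.
Qed.

(** In a growing step the old vertex already has a neighbour, and acquires a
second one; a component with a single edge has no room for it. *)
Lemma matching_starts s : greedy s -> disjoint_union_of_edges e ->
  num_starts s = size s.
Proof.
move=> gs union_e.
elim: gs => [|v w {}s gs IH evw vs ws|v w {}s _ IH _ _ vs _] //=; last first.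
  by rewrite vs IH.
have [z lz] := endpoints_listed vs; have ez := greedy_edge gs lz.
have zw : z != w.
  apply: contraNneq ws => <-; apply: (@listed_endpoints _ _ v).
  by rewrite listed_sym.
have [v' [_ /setP cv]] := union_e v.
have neigh y : e v y -> y = v'.
  move=> evy; move: (cv y); rewrite !inE connect1 //.
  case/esym/orP => /eqP // yv; by rewrite yv e_irr in evy.
by rewrite (neigh _ ez) (neigh _ evw) eqxx in zw.
Qed.

(** When all steps are starts, each new edge is disjoint from all earlier
ones. *)
Lemma starts_matching s x y z : greedy s -> num_starts s = size s ->
  listed s x y -> listed s x z -> y = z.
Proof.
move=> gs; elim: gs => [|v w {}s gs IH evw vs ws|v w {}s _ IH _ evw vs ws] //=.
  by rewrite vs add0n => eqs; have := num_starts_le s; rewrite eqs ltnn.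
rewrite vs add1n => -[eqs].
have vw : (v == w) = false by apply: contraTF evw => /eqP ->; rewrite e_irr.
have lcons a b : listed ((v, w) :: s) a b ->
    [\/ a = v /\ b = w, a = w /\ b = v | listed s a b].
  rewrite /listed !inE => /orP [] /orP [/eqP [-> ->]|h];
    [exact: Or31|by apply: Or33; rewrite h|exact: Or32|by apply: Or33; rewrite h orbT].
move=> /lcons [[xv yw]|[xw yv]|lxy] /lcons [[xv' zw]|[xw' zv]|lxz].
- by rewrite yw zw.
- by rewrite -xv xw' eqxx in vw.
- by rewrite -xv (listed_endpoints lxz) in vs.
- by rewrite -xw -xv' eqxx in vw.
- by rewrite yv zv.
- by rewrite -xw (listed_endpoints lxz) in ws.
- by rewrite -xv' (listed_endpoints lxy) in vs.
- by rewrite -xw' (listed_endpoints lxy) in ws.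
exact: IH lxy lxz.
Qed.

Lemma starts_disjoint_union s : no_isolated_vertex e -> greedy s ->
  num_starts s = size s -> (forall x y, e x y -> listed s x y) ->
  disjoint_union_of_edges e.
Proof.
move=> noiso gs all_starts all_listed u; have [v euv] := noiso u.
have uniq_neigh x y z : e x y -> e x z -> y = z.
  by move=> /all_listed lxy /all_listed; apply: starts_matching lxy.
exists v; split=> //; apply/setP => x; rewrite !inE; apply/idP/orP; last first.
  by case=> /eqP ->; rewrite ?connect0 ?connect1.
case/connectP => p ep ->.
(* Having a single neighbour each, [u] and [v] are not left by any path. *)
have stays a : a == u \/ a == v -> path e a p -> last a p == u \/ last a p == v.
  elim: p a {ep} => //= z p IH a ha /andP [eaz]; apply: IH.
  case: ha => /eqP ha; rewrite ha in eaz.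
    by right; apply/eqP/(uniq_neigh _ _ _ eaz euv).
  by left; apply/eqP/(uniq_neigh _ _ _ eaz); rewrite e_sym.
by apply: stays ep; left.
Qed.

Lemma disconnected_components : disconnected e -> (1 < num_components e)%N.
Proof.
move=> [u [v uv]]; rewrite num_components_roots.
have ruv : fingraph.root e u != fingraph.root e v.
  by apply: contra uv => /eqP /(fingraph.rootP e_connect_sym).
suff: (#|[set fingraph.root e u; fingraph.root e v]| <=
    #|[set fingraph.root e x | x : 'I_n]|)%N by rewrite cards2 ruv.
apply/subset_leq_card/subsetP => x; rewrite !inE.
by case/orP=> /eqP ->; apply: imset_f.
Qed.

End GreedyOrder.

(** * Resolving the complementary edge ideal *)

Section Monomials.
Variables (n : nat) (K : fieldType).
Local Notation S := {mpoly K[n]}.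
Local Notation edge_monomial := (complementary_edge_monomial K).
Implicit Types (v w x y z : 'I_n).

(** A monomial without $x_w$ is a non-zero-divisor modulo $x_w$. *)
Lemma dvd_mulX_monomial w (a q : S) (M : 'X_{1..n}) :
  M w = 0%N -> a * 'X_[M] = q * 'X_w -> exists q', a = q' * 'X_w.
Proof.
move=> Mw0 eq_aq.
have supp_w k : k \in msupp a -> (U_(w) <= k)%MM.
  move=> ka; apply/mnm_lepP => i; rewrite mnm1E; case: eqP => // <-.
  have : (M + k)%MM \in msupp (q * 'X_w).
    by rewrite -eq_aq mcoeff_msupp mcoeffMX -mcoeff_msupp.
  rewrite (perm_mem (msuppMX _ _)) => /mapP [k' _].
  move=> /(congr1 (fun m : 'X_{1..n} => m w)).
  by rewrite !mnmDE Mw0 mnm1E eqxx add0n => ->.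
(* Every exponent of [a] contains [w], so each monomial can be divided. *)
exists (\sum_(k <- msupp a) a@_k *: 'X_[(k - U_(w))%MM]).
rewrite {1}[a]mpolyE mulr_suml; apply: eq_big_seq => k /supp_w wk.
by rewrite -scalerAl -mpolyXD submK.
Qed.

Definition vertex_monomial : S := \prod_(k < n) 'X_k.
Definition vertex_monomial_but v : S := \prod_(k < n | k != v) 'X_k.

Lemma edge_monomialC v w : edge_monomial v w = edge_monomial w v.
Proof. by apply: eq_bigl => k; rewrite andbC. Qed.

Lemma mul_X_edge_monomial v w :
  v != w -> 'X_w * edge_monomial v w = vertex_monomial_but v.
Proof.
by move=> vw; rewrite /vertex_monomial_but (bigD1 w) // eq_sym.
Qed.

Lemma mul_XX_edge_monomial v w :
  v != w -> 'X_v * 'X_w * edge_monomial v w = vertex_monomial.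
Proof.
by move=> vw; rewrite -mulrA mul_X_edge_monomial // /vertex_monomial (bigD1 v).
Qed.

Definition edge_exponent v w : 'X_{1..n} :=
  [multinom nat_of_bool ((k != v) && (k != w)) | k < n].

Lemma edge_monomialE v w : edge_monomial v w = 'X_[edge_exponent v w].
Proof.
rewrite mpolyXE_id /complementary_edge_monomial big_mkcond; apply: eq_bigr => k _.
by rewrite mnmE; case: ifP; rewrite ?expr1 ?expr0.
Qed.

Lemma mdeg_edge_exponent v w : v != w -> mdeg (edge_exponent v w) = (n - 2)%N.
Proof.
move=> vw; rewrite mdegE.
rewrite (eq_bigr (fun k => if k \in ~: [set v; w] then 1 else 0)%N) => [|k _].
  by rewrite -big_mkcond sum1_card cardsCs setCK card_ord cards2 vw.
by rewrite mnmE !inE negb_or; case: ifP.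
Qed.

Lemma edge_monomial_neq0 v w : edge_monomial v w != 0.
Proof. by rewrite edge_monomialE -msupp_eq0 msuppX. Qed.

Lemma X_dvd_edge_monomial w x y :
  w != x -> w != y -> exists q, edge_monomial x y = q * 'X_w.
Proof.
move=> wx wy; rewrite /complementary_edge_monomial (bigD1 w) ?wx //=.
by rewrite mulrC; eexists.
Qed.

End Monomials.

Section GreedyResolution.
Variables (n : nat) (K : fieldType) (e : rel 'I_n).
Hypotheses (e_sym : ssrbool.symmetric e) (e_irr : irreflexive e).
Local Notation S := {mpoly K[n]}.
Local Notation edge_monomial := (complementary_edge_monomial K).
Implicit Types (s : seq ('I_n * 'I_n)) (v w x y z : 'I_n).

(** Indexing the generators by positions in the list keeps the block structure
of [kernel_basis_cons]. *)
Definition edge_generators s : 'cV[S]_(size s) :=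
  \col_i edge_monomial (tnth (in_tuple s) i).1 (tnth (in_tuple s) i).2.

Lemma edge_generators_cons v w s :
  edge_generators ((v, w) :: s) =
    col_mx (edge_monomial v w)%:M (edge_generators s) :> 'cV_(1 + size s).
Proof.
apply/colP => i; rewrite -[i in RHS]splitK mxE.
case: splitP => j /= ij; rewrite ?col_mxEu ?col_mxEd !mxE (tnth_nth (v, w)) /= ij.
  by rewrite ord1.
by rewrite (tnth_nth (v, w)).
Qed.

(** The last edge of the list, which is the first one chosen, contributes no
syzygy; the others contribute one each, linear for a growing step and
quadratic for a start. *)
Fixpoint syzygy_degrees s : seq int :=
  match s with
  | x :: (_ :: _) as s' =>
      (if x.1 \in endpoints s' then n%:Z - 1 else n%:Z) :: syzygy_degrees s'
  | _ => [::]
  end.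

Lemma mem_endpoints s (p : 'I_n * 'I_n) :
  p \in s -> p.1 \in endpoints s /\ p.2 \in endpoints s.
Proof.
case: p => x y xs; split; first by apply: (@listed_endpoints _ _ _ y); rewrite /listed xs.
by apply: (@listed_endpoints _ _ _ x); rewrite /listed xs orbT.
Qed.

Lemma fresh_vertex_dvd w s (u : 'rV_(size s)) : w \notin endpoints s ->
  exists q, (u *m edge_generators s) 0 0 = q * 'X_w.
Proof.
move=> ws; have /fin_all_exists [f hf] i : exists q, edge_generators s i 0 = q * 'X_w.
  have [h1 h2] := mem_endpoints (mem_tnth i (in_tuple s)).
  rewrite mxE.
  by apply: X_dvd_edge_monomial; apply: contraNneq ws => ->; [exact: h1|exact: h2].
exists (\sum_i u 0 i * f i); rewrite mxE mulr_suml; apply: eq_bigr => i _.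
by rewrite hf mulrA.
Qed.

(** The inclusion of the colon ideal in $(x_w)$: a fresh vertex $w$ divides
every earlier generator but not the generator of its own edge. *)
Lemma edge_colon_vertex v w s a (u : 'rV_(size s)) : w \notin endpoints s ->
  a * edge_monomial v w + (u *m edge_generators s) 0 0 = 0 -> exists q, a = q * 'X_w.
Proof.
move=> ws; have [b ->] := fresh_vertex_dvd u ws.
move=> /eqP; rewrite addr_eq0 -mulNr edge_monomialE => /eqP.
by apply: dvd_mulX_monomial; rewrite mnmE eqxx andbF.
Qed.

(** At a start both ends of the edge are fresh, and the two divisibilities
combine because $x_w m_{vw}$ is still free of $x_v$. *)
Lemma edge_colon_edge v w s a (u : 'rV_(size s)) : v != w ->
  v \notin endpoints s -> w \notin endpoints s ->
  a * edge_monomial v w + (u *m edge_generators s) 0 0 = 0 ->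
  exists q, a = q * ('X_v * 'X_w).
Proof.
move=> vw vs ws au; have [q eq_a] := edge_colon_vertex ws au.
have [b eq_b] := fresh_vertex_dvd u vs.
have [q' eq_q] : exists q', q = q' * 'X_v.
  apply: (@dvd_mulX_monomial _ _ _ q (- b) (edge_exponent v w + U_(w))%MM).
    by rewrite mnmDE mnmE eqxx mnm1E [w == v]eq_sym (negbTE vw).
  rewrite mpolyXD -edge_monomialE mulNr -eq_b; apply/eqP.
  by rewrite -addr_eq0 (mulrC (edge_monomial v w)) mulrA -eq_a au.
by exists q'; rewrite eq_a eq_q mulrA.
Qed.

Definition resolved s : Prop :=
  exists D : 'M[S]_(size (syzygy_degrees s), size s),
    homogeneous_mx (fun a => (syzygy_degrees s)`_a) (fun=> n%:Z - 2) D /\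
    kernel_basis (edge_generators s) D.

Lemma resolved_single v w : resolved [:: (v, w)].
Proof.
exists 0; split; first by case.
have -> : edge_generators [:: (v, w)] = (edge_monomial v w)%:M.
  by apply/matrixP => i j; rewrite !ord1 !mxE.
exact/kernel_basis_single/edge_monomial_neq0.
Qed.

(** One application of [kernel_basis_cons] with monomial data: a single
earlier edge [t] suffices to realize the generator [mc] of the colon ideal. *)
Lemma resolved_cons v w s (t : 'I_(size s)) (mc mr : 'X_{1..n}) :
  let d := (syzygy_degrees ((v, w) :: s))`_0 in
  let edge_t := tnth (in_tuple s) t in
  resolved s ->
  (mdeg mc)%:Z + (n%:Z - 2) = d -> (mdeg mr)%:Z + (n%:Z - 2) = d ->
  'X_[mc] * edge_monomial v w = 'X_[mr] * edge_monomial edge_t.1 edge_t.2 ->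
  (forall a (u : 'rV_(size s)),
     a * edge_monomial v w + (u *m edge_generators s) 0 0 = 0 ->
     exists q, a = q * 'X_[mc]) ->
  resolved ((v, w) :: s).
Proof.
case: s t => [|y s] t; first by case: t.
move=> d edge_t [D [homD basisD]] dc dr eq_c colon.
pose r : 'rV[S]_(size (y :: s)) := 'X_[mr] *: delta_mx 0 t.
exists (block_mx ('X_[mc])%:M (- r) 0 D : 'M_(1 + _, 1 + _)); split; last first.
  rewrite edge_generators_cons; apply: kernel_basis_cons => //.
    by rewrite -msupp_eq0 msuppX.
  by rewrite eq_c -scalemxAl -rowE !mxE.
apply: (@homogeneous_block _ _ 1 (size (syzygy_degrees (y :: s)))
          1 (size (y :: s))) => a b m /=; rewrite ?ord1 /=.
- by rewrite mxE eqxx msuppX inE => /eqP ->.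
- rewrite !mxE eqxx /= (perm_mem (msuppN _)); case: (b == t).
    by rewrite mulr1 msuppX inE => /eqP ->.
  by rewrite mulr0 msupp0.
- by rewrite mxE msupp0.
exact: homD.
Qed.

Lemma greedy_mem s (p : 'I_n * 'I_n) : greedy e s -> p \in s -> e p.1 p.2.
Proof.
move=> gs ps; apply: (greedy_edge e_sym gs).
by rewrite /listed -surjective_pairing ps.
Qed.

(** A growing edge $vw$ is compared with an earlier edge $vz$, using
$x_w m_{vw} = x_1 \cdots x_n / x_v = x_z m_{vz}$; at a start any earlier edge
serves, since $x_v x_w m_{vw} = x_1 \cdots x_n$ for all edges. *)
Lemma greedy_resolved s : greedy e s -> s != [::] -> resolved s.
Proof.
have pos v w : e v w -> v != w by apply: contraTneq => ->; rewrite e_irr.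
move=> gs; elim: gs => {s} [|v w s gs IH evw vs ws|v w s gs IH _ evw vs ws] // _.
- have [z lz] := endpoints_listed vs.
  have ss : s != [::] by case: (s) vs; rewrite // inE.
  have vz : e v z by apply: greedy_edge lz.
  have [t ht] : exists t, let x := tnth (in_tuple s) t in x = (v, z) \/ x = (z, v).
    by case/orP: lz => /(tnthP (in_tuple _)) [t ht]; exists t; [left|right].
  apply: (@resolved_cons v w s t U_(w) U_(z)); rewrite ?mdeg1; first exact: IH.
  + by case: (s) ss vs => //= a s' _ ->; rewrite addrCA.
  + by case: (s) ss vs => //= a s' _ ->; rewrite addrCA.
  + rewrite mul_X_edge_monomial ?pos //.
    case: ht => ->; rewrite /= 1?[edge_monomial z v]edge_monomialC;
      by rewrite mul_X_edge_monomial ?pos.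
  by move=> a u; apply: edge_colon_vertex.
have [->|ss] := eqVneq s [::]; first exact: resolved_single.
have size_s : (0 < size s)%N by case: (s) ss.
pose t := Ordinal size_s.
set x := tnth (in_tuple s) t.
apply: (@resolved_cons v w s t (U_(v) + U_(w))%MM (U_(x.1) + U_(x.2))%MM);
  rewrite ?mdegD ?mdeg1; first exact: IH.
- by case: (s) ss vs => //= a s' _ /negbTE ->; rewrite addrC subrK.
- by case: (s) ss vs => //= a s' _ /negbTE ->; rewrite addrC subrK.
- by rewrite !mpolyXD !mul_XX_edge_monomial ?pos ?(greedy_mem gs) ?mem_tnth.
by move=> a u; rewrite mpolyXD; apply: edge_colon_edge; rewrite ?pos.
Qed.

Lemma syzygy_degrees_count s : greedy e s -> s != [::] ->
  forall j : int, count_mem j (syzygy_degrees s) =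
    ((j == n%:Z)%R * (num_starts s).-1
       + (j == n%:Z - 1)%R * (size s - num_starts s))%N.
Proof.
elim: s => // -[v w] [|y s] IH gs _ j.
  by rewrite /= inE /= subnn !muln0.
have /IH/(_ isT j) eqj : greedy e (y :: s) by inversion gs.
have gs' : greedy e (y :: s) by inversion gs.
have starts_gt0 := num_starts_gt0 e_sym gs' isT.
have starts_le := num_starts_le (y :: s).
have -> : num_starts [:: (v, w), y & s] =
  ((v \notin endpoints (y :: s)) + num_starts (y :: s))%N by [].
have -> : size [:: (v, w), y & s] = (size (y :: s)).+1 by [].
have -> : syzygy_degrees [:: (v, w), y & s] =
  (if v \in endpoints (y :: s) then n%:Z - 1 else n%:Z)
    :: syzygy_degrees (y :: s) by [].
move: (num_starts _) (size _) (syzygy_degrees _) (endpoints _) eqj starts_gt0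
  starts_le => k m ds U eqj k_gt0 le_km.
rewrite [count_mem _ _]/= eqj [_ == j]eq_sym.
case: (v \in U); rewrite ?add0n ?add1n /=.
  by rewrite subSn // mulnS addnCA.
by rewrite subSS addnA -mulnS prednK.
Qed.

Lemma edge_ideal_generators s : (forall p, p \in s -> e p.1 p.2) ->
  (forall x y, e x y -> listed s x y) ->
  forall f, complementary_edge_ideal (K := K) e f <->
    exists u : 'rV_(size s), (u *m edge_generators s) 0 0 = f.
Proof.
move=> se es f; split=> [[m [a [g [hg ->]]]]|[u <-]].
  have /fin_all_exists [h hh] k : exists u : 'rV_(size s),
      (u *m edge_generators s) 0 0 = g k.
    have [i [j [eij ->]]] := hg k.
    case/orP: (es _ _ eij) => /(tnthP (in_tuple _)) [t ht].
      by exists (delta_mx 0 t); rewrite -rowE !mxE -ht.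
    by exists (delta_mx 0 t); rewrite -rowE !mxE -ht /= edge_monomialC.
  exists (\sum_k a k *: h k); rewrite mulmx_suml summxE; apply: eq_bigr => k _.
  by rewrite -scalemxAl mxE hh.
exists (size s), (fun k => u 0 k), (fun k => edge_generators s k 0); split.
  move=> k; exists (tnth (in_tuple s) k).1, (tnth (in_tuple s) k).2.
  by rewrite mxE; split=> //; apply/se/mem_tnth.
by rewrite mxE.
Qed.

End GreedyResolution.

(** * Betti numbers *)

Lemma card_nth_count (T : eqType) (x0 : T) (ds : seq T) (d : T) :
  #|[pred b : 'I_(size ds) | nth x0 ds b == d]| = count_mem d ds.
Proof.
rewrite -sum1_card -sum1_count (big_nth x0) big_mkord.
by apply: eq_bigl => b; rewrite inE.
Qed.

Section BettiNumbers.
Variables (n : nat) (K : fieldType) (e : rel 'I_n).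
Hypotheses (e_sym : ssrbool.symmetric e) (e_irr : irreflexive e).
Hypotheses (noiso : no_isolated_vertex e) (forest_e : forest e).
Hypothesis n_gt1 : (1 < n)%N.

Lemma edge_generators_homogeneous (s : seq ('I_n * 'I_n)) : greedy e s ->
  homogeneous_mx (fun=> n%:Z - 2) (fun=> 0) (edge_generators K s).
Proof.
move=> gs a b m; rewrite addr0 mxE edge_monomialE msuppX inE => /eqP ->.
rewrite mdeg_edge_exponent ?subzn //.
by apply: contraTneq (greedy_mem e_sym gs (mem_tnth a (in_tuple s))) => ->; rewrite e_irr.
Qed.

(** The list [s] stays in the conclusion because the vanishing of
$\beta_{1,n-1}$ is decided on its steps. *)
Lemma forest_betti : exists s, [/\ greedy e s, endpoints s = [set: 'I_n],
    forall x y, e x y -> listed s x y, num_starts s = num_components e &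
    forall i j, graded_betti (complementary_edge_ideal (K := K) e) i j =
      match i with
      | 0%N => (j == n%:Z - 2)%R * size s
      | 1%N => (j == n%:Z)%R * (num_components e).-1
               + (j == n%:Z - 1)%R * (size s - num_components e)
      | _ => 0
      end%N].
Proof.
have [s [gs full]] := greedy_spanning e_sym noiso.
have s0 : s != [::].
  apply: contraTneq n_gt1 => s0; move: full; rewrite s0 => /setP.
  by case: (n) => // n' /(_ ord0); rewrite !inE.
have all_listed x y : e x y -> listed s x y by apply: forest_listed.
have starts : num_starts s = num_components e.
  rewrite (num_starts_roots e_sym gs) (num_components_roots e_sym) full.
  by apply: eq_card => x; apply/imsetP/imsetP => -[y _ ->]; exists y.
have counts := syzygy_degrees_count e_sym gs s0; rewrite starts in counts.
exists s; split=> // i j.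
(* The list is nonempty, and its resolution is minimal: the syzygies have
   degree [n - 1] or [n], the generators degree [n - 2]. *)
have [D [homD basisD]] := greedy_resolved K e_sym e_irr gs s0.
have s_edges p : p \in s -> e p.1 p.2 by apply: greedy_mem.
have image := @edge_ideal_generators n K e s s_edges all_listed.
rewrite (length_one_betti (edge_generators_homogeneous gs) homD basisD image).
  case: i => [|[|i]] //; last by rewrite card_nth_count counts.
  rewrite -(eq_card (A := [pred b : 'I_(size s) | j == n%:Z - 2])); last first.
    by move=> b; rewrite !inE eq_sym.
  case: (_ == _); last by rewrite eq_card0.
  by rewrite mul1n -[RHS]card_ord; apply: eq_card.
apply: (homogeneous_at0 homD) => a b; apply/negP => /eqP eq_a.
have : (0 < count_mem (n%:Z - 2)%R (syzygy_degrees s))%N.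
  by rewrite -has_count has_pred1 -eq_a mem_nth.
by rewrite counts -subr_eq0 addrAC subrr (inj_eq (addrI _)).
Qed.

End BettiNumbers.

Theorem theorem3p3 (n : nat) (hn : (4 <= n)%N) (K : fieldType) (e : rel 'I_n)
  (hG : simple_graph e) (hiso : no_isolated_vertex e)
  (hforest : forest e) (hdisc : disconnected e) :
  let beta := graded_betti (complementary_edge_ideal (K := K) e) in
  (forall (i : nat) (j : int),
     (i, j) \notin [:: (0%N, n%:Z - 2); (1%N, n%:Z - 1); (1%N, n%:Z)] ->
     beta i j = 0%N)
  /\ beta 0%N (n%:Z - 2) = (n - num_components e)%N
  /\ beta 1%N n%:Z <> 0%N
  /\ (beta 1%N (n%:Z - 1) <> 0%N <-> ~ disjoint_union_of_edges e).
Proof.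
have [e_sym e_irr] := hG; have n_gt1 : (1 < n)%N by apply: leq_trans hn.
have [s [gs full all_listed starts betti]] :=
  forest_betti K e_sym e_irr hiso hforest n_gt1.
have comps_gt1 := disconnected_components e_sym hdisc.
have size_s : (size s + num_components e)%N = n.
  by rewrite -starts -(size_greedy e_irr gs) full cardsT card_ord.
have ne1 : (n%:Z == n%:Z - 1) = false.
  by apply/negbTE; rewrite eq_sym -subr_eq0 addrAC subrr.
split; [|split; [|split]].
- move=> i j; rewrite betti !inE !xpair_eqE; case: i => [|[|i]] //=.
    by case: (j == _).
  by rewrite negb_or => /andP [/negbTE -> /negbTE ->].
- by rewrite betti eqxx mul1n -(addnK (num_components e) (size s)) size_s.
- rewrite betti eqxx ne1 mul1n addn0.
  by case: (num_components e) comps_gt1 => [|[|c]].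
rewrite betti eqxx [_ == n%:Z]eq_sym ne1 mul1n add0n -starts.
split=> [neq0 union_e|not_union].
  by rewrite (matching_starts e_sym e_irr gs union_e) subnn in neq0.
move=> /eqP; rewrite subn_eq0 => le_s; apply: not_union.
apply: (starts_disjoint_union e_sym e_irr hiso gs _ all_listed).
by apply/eqP; rewrite eqn_leq le_s num_starts_le.
Qed.
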